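(* Let $k,d$ be positive integers and let $G$ be a graph. Then \[ b_k(G) \leq \beta'(H_{k,d}(G)) + d. \] Equivalently, if there exists a partition of $V(G)$ into $T$ sets, each of cardinality at most $k$ and of diameter at most $d$ with respect to distance in $G$, then \[ b_k(G) \leq T + d. \]
   Context: All graphs are finite, simple and undirected. $H_{k,d}(G)$ is the hypergraph with vertex set $V(G)$ whose edges are all (nonempty) subsets of $V(G)$ of cardinality at most $k$ and diameter at most $d$ with respect to distance in $G$ (a set $S$ has diameter at most $d$ if $d_G(u,v)\le d$ for all $u,v\in S$). An edge cover of a hypergraph $H$ is a set of edges whose union is $V(H)$; $\beta'(H)$ is the minimum cardinality of an edge cover of $H$. $k$-liminal burning game on $G$ ($k$ a positive integer): two players, Saboteur and Arsonist. Each vertex is burned or unburned, and revealed or unrevealed; initially all are unburned and unrevealed. In each round: (i) propagation: every unburned vertex with a neighbor burned in an earlier round becomes burned (whether revealed or not); (ii) the Saboteur reveals $k$ vertices that are unrevealed and unburned (all such vertices if fewer than $k$ exist); revealed vertices stay revealed; (iii) the Arsonist burns one revealed unburned vertex (revealed in this or any earlier round), if one exists. The game ends in the round in which all vertices are burned. The Saboteur maximizes and the Arsonist minimizes the number of rounds; $b_k(G)$ is the number of rounds under optimal play. *)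

(* Defs.v *)
From mathcomp Require Import all_boot.

Set Implicit Arguments.
Unset Strict Implicit.
Unset Printing Implicit Defensive.

(* A finite simple graph is a symmetric irreflexive relation
   [e : rel V] on [V : finType]; it need not be connected. *)

Section Distance.
Variables (V : finType) (e : rel V).

Definition has_walk (u v : V) (n : nat) : bool :=
  [exists p : n.-tuple V, path e u p && (last u p == v)].

(* [None] is the infinite distance between distinct components. A shortest
   walk repeats no vertex, so only lengths below [#|V|] need be searched. *)
Definition gdist (u v : V) : option nat :=
  let n := find (has_walk u v) (iota 0 #|V|) in
  if n < #|V| then Some n else None.

Definition dist_le (d : nat) (u v : V) : bool :=
  if gdist u v is Some n then n <= d else false.

Definition diam_le (d : nat) (S : {set V}) : bool :=
  [forall u in S, forall v in S, dist_le d u v].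

Lemma has_walkP u v n :
  reflect (exists p, [/\ path e u p, last u p = v & size p = n])
          (has_walk u v n).
Proof.
apply: (iffP existsP) => [[p /andP[ep /eqP lp]]|[p [ep lp sp]]].
  by exists p; rewrite size_tuple.
have sp' : size p == n by apply/eqP.
by exists (Tuple sp') => /=; rewrite ep lp eqxx.
Qed.

Lemma dist_leP d u v :
  reflect (exists p, [/\ path e u p, last u p = v & size p <= d])
          (dist_le d u v).
Proof.
rewrite /dist_le /gdist; set P := has_walk u v.
have fP : find P (iota 0 #|V|) < #|V| -> P (find P (iota 0 #|V|)).
  move=> lt; have hasP : has P (iota 0 #|V|) by rewrite has_find size_iota.
  by have := nth_find 0 hasP; rewrite nth_iota.
apply: (iffP idP) => [|[p [ep lp sp]]].
  case: ifP => // /fP /has_walkP [p [ep lp sp]] le.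
  by exists p; rewrite sp.
move: lp; case/shortenP: ep => q eq uq sub_qp lq.
have szq : size q < #|V|.
  by rewrite -[(size q).+1]/(size (u :: q)) -(card_uniqP uq) max_card.
have leq_qp : size q <= size p.
  by apply: uniq_leq_size => //; case/andP: uq.
have Pq : P (size q) by apply/has_walkP; exists q.
have hasq : has P (iota 0 #|V|).
  by apply/hasP; exists (size q); rewrite ?mem_iota.
move: (hasq); rewrite has_find size_iota => lt; rewrite lt.
apply: leq_trans (leq_trans leq_qp sp); rewrite leqNgt; apply/negP => ltq.
by have := before_find 0 ltq; rewrite nth_iota // add0n Pq.
Qed.

End Distance.

Section Hypergraph.
Variable V : finType.

(* A hypergraph on the vertex set [V] is given by its set of edges. *)
Definition edge_cover (H C : {set {set V}}) : bool :=
  (C \subset H) && (cover C == [set: V]).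

(* [H] covers as soon as some edge cover exists; it is then a legitimate
   starting point for the minimization. *)
Definition edge_cover_number (H : {set {set V}}) : nat :=
  #|[arg min_(C < H | edge_cover H C) #|C|]|.

Definition diam_hypergraph (k d : nat) (e : rel V) : {set {set V}} :=
  [set S : {set V} | [&& S != set0, #|S| <= k & diam_le e d S]].

Lemma edge_cover_numberP (H C0 : {set {set V}}) :
  edge_cover H C0 ->
  (exists2 C, edge_cover H C & #|C| = edge_cover_number H) /\
  (forall C, edge_cover H C -> edge_cover_number H <= #|C|).
Proof.
move=> /andP[sC0 /eqP cC0]; rewrite /edge_cover_number.
have HH : edge_cover H H.
  rewrite /edge_cover subxx -subTset -cC0; apply/bigcupsP => S SC0.
  by apply: (bigcup_sup S) => //; apply: (subsetP sC0).
by case: arg_minnP => // C HC minC; split=> //; exists C.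
Qed.

Lemma diam_hypergraph_cover (k d : nat) (e : rel V) :
  0 < k -> edge_cover (diam_hypergraph k d e) [set [set x] | x in V].
Proof.
move=> k_gt0; apply/andP; split.
  apply/subsetP => _ /imsetP[x _ ->]; rewrite inE cards1 k_gt0 andTb.
  apply/andP; split; first by apply/set0Pn; exists x; rewrite inE.
  apply/forall_inP => u /set1P ->; apply/forall_inP => v /set1P ->.
  by apply/dist_leP; exists [::].
rewrite -subTset; apply/subsetP => x _; apply/bigcupP; exists [set x].
  exact: imset_f.
exact: set11.
Qed.

End Hypergraph.

Section Game.
Variables (V : finType) (k : nat) (e : rel V).

Definition spread (B : {set V}) : {set V} :=
  B :|: [set v | [exists u in B, e u v]].

Definition legal_reveal (B R S : {set V}) : bool :=
  (S \subset ~: (B :|: R)) && (#|S| == minn k #|~: (B :|: R)|).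

(* The possible burned sets after the Arsonist's move; burning is mandatory
   whenever a revealed unburned vertex exists. *)
Definition burn_options (B R : {set V}) : {set {set V}} :=
  if R :\: B == set0 then [set B] else [set v |: B | v in R :\: B].

(* Minimax number of further rounds from burned set [B] and revealed set [R],
   for the game truncated after [n] rounds. A value of the game truncated
   after [m] rounds is at most [m], which makes [m] neutral for this [minn];
   the set of options is never empty. *)
Fixpoint rounds (n : nat) (B R : {set V}) : nat :=
  if B == [set: V] then 0
  else if n is m.+1 then
    let B' := spread B in
    (\max_(S : {set V} | legal_reveal B' R S)
       \big[minn/m]_(X in burn_options B' (R :|: S))
          rounds m X (R :|: S)).+1
  else 0.

(* When [0 < k] every round burns a new vertex, so that truncation after
   [#|V|] rounds has no effect: see [rounds_stable]. *)
Definition burning_number : nat := rounds #|V| set0 set0.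

Lemma rounds_le n B R : rounds n B R <= n.
Proof.
elim: n B R => [|n IHn] B R /=; case: ifP => // _.
rewrite ltnS; apply/bigmax_leqP => S _.
by elim/big_ind: _ => // x y lx _; rewrite geq_min lx.
Qed.

Lemma bigmin_idx (I : finType) (A : {set I}) (F : I -> nat) a b :
  A != set0 -> (forall i, i \in A -> F i <= a /\ F i <= b) ->
  \big[minn/a]_(i in A) F i = \big[minn/b]_(i in A) F i.
Proof.
move=> /set0Pn[i0 Ai0] leF.
have aux c c' : (forall i, i \in A -> F i <= c') ->
    \big[minn/c]_(i in A) F i <= \big[minn/c']_(i in A) F i.
  move=> leF'.
  have low i : i \in A -> \big[minn/c]_(j in A) F j <= F i.
    move=> Ai; have := mem_index_enum i; elim: (index_enum I) => // j r IH.
    rewrite inE big_cons => /orP[/eqP <-|/IH le]; first by rewrite Ai geq_minl.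
    by case: ifP => // _; rewrite geq_min le orbT.
  move: low; set x0 := \big[minn/c]_(i in A) F i => low.
  elim/big_rec: _ => [|i x Ai lx]; first exact: leq_trans (low _ Ai0) (leF' _ Ai0).
  by rewrite leq_min low.
by apply/eqP; rewrite eqn_leq !aux // => i /leF[].
Qed.

Lemma burn_options_neq0 B R : burn_options B R != set0.
Proof.
rewrite /burn_options; case: ifPn => [_|/set0Pn[v vA]]; apply/set0Pn.
  by exists B; rewrite inE.
by exists (v |: B); apply: imset_f.
Qed.

Lemma card_burn_options B R S X :
  0 < k -> B != [set: V] -> legal_reveal (spread B) R S ->
  X \in burn_options (spread B) (R :|: S) -> #|~: X| < #|~: B|.
Proof.
move=> k_gt0 BT /andP[sS /eqP cS].
have sB : B \subset spread B by apply: subsetUl.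
rewrite /burn_options; case: ifPn => [/eqP A0 /set1P -> | _ /imsetP[v vA ->]].
  have S0 : S = set0.
    apply/setP => x; rewrite [RHS]inE; apply/negP => Sx.
    have := subsetP sS _ Sx; rewrite !in_setC in_setU negb_or => /andP[nB _].
    by have := in_set0 x; rewrite -A0 in_setD nB in_setU Sx orbT.
  have cA : #|~: (spread B :|: R)| = 0.
    by move: cS; rewrite S0 cards0; case: leqP => // _ k0; rewrite -k0 in k_gt0.
  have spT : spread B = [set: V].
    apply/setP => x; rewrite [RHS]inE; apply/negPn/negP => nx.
    have xR : x \in R.
      have := in_set0 x; rewrite -(cards0_eq cA) in_setC in_setU (negbTE nx) /=.
      by move/negbFE.
    by have := in_set0 x; rewrite -A0 in_setD nx in_setU xR.
  by rewrite spT setCT cards0 card_gt0; apply: contra BT => /eqP E; rewrite -(setCK B) E setC0.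
apply: proper_card; rewrite properEneq; apply/andP; split; last first.
  by rewrite setCS (subset_trans sB) // subsetUr.
move: vA; rewrite in_setD => /andP[nv _]; apply/eqP => /setP/(_ v).
by rewrite !in_setC setU11 (contra (subsetP sB v) nv).
Qed.

Lemma rounds_stable m n B R :
  0 < k -> #|~: B| <= m -> #|~: B| <= n -> rounds m B R = rounds n B R.
Proof.
move=> k_gt0.
have dead X Y p q : #|~: X| <= 0 -> rounds p X Y = rounds q X Y.
  rewrite leqn0 => /eqP/cards0_eq E.
  have XT : X == [set: V] by rewrite -(setCK X) E setC0.
  by case: p q => [|p] [|q] /=; rewrite XT.
elim: m n B R => [|m IHm] [|n] B R lm ln; try exact: dead.
rewrite /=; case: ifPn => // BT; congr S; apply: eq_bigr => S lS.
have lt X : X \in burn_options (spread B) (R :|: S) -> #|~: X| <= m /\ #|~: X| <= n.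
  move=> /(card_burn_options k_gt0 BT lS) lX.
  by split; rewrite -ltnS; apply: leq_trans lX _.
under eq_bigr => X /lt[lXm lXn] do rewrite (IHm n) //.
apply: bigmin_idx => [|X /lt[lXm lXn]]; first exact: burn_options_neq0.
by rewrite -{1}(IHm n) // !rounds_le.
Qed.

End Game.

(* Main.v *)
Require Import Defs.
From mathcomp Require Import all_boot.
From mathcomp Require Import order zify.

(** The Arsonist hits a new set of the cover in each of the first [T] rounds.
    If only [j] sets are hit after [j] rounds, then in the next round either
    [k * j.+1] vertices are revealed, too many to lie in [j] sets of size at
    most [k], or every unburned vertex is revealed; in both cases some revealed
    vertex lies in a set not hit yet. Once every set of the cover contains a
    burned vertex, [d] propagations burn the whole graph. *)

Section Arsonist.
Set Implicit Arguments.
Unset Strict Implicit.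
Variables (V : finType) (k : nat) (e : rel V).
Implicit Types (B R S X : {set V}) (C : {set {set V}}).

(** One good reply [X] to each [S] bounds the minimum inside the maximum. The bound is asked for
    every truncation [m], so that later inductions run on the bound instead. *)
Lemma rounds_leS n c B R :
    (forall S, legal_reveal k (spread e B) R S ->
       exists2 X, X \in burn_options (spread e B) (R :|: S) &
                  forall m, rounds k e m X (R :|: S) <= c) ->
  rounds k e n B R <= c.+1.
Proof.
move=> strat; case: n => [|n] /=; case: ifP => // _.
rewrite ltnS; apply/bigmax_leqP => S /strat[X optX leX].
exact: (@Order.TotalTheory.bigmin_inf _ nat _ n X _ c _ optX (leX n)).
Qed.

Lemma burn_options_sub B R X : X \in burn_options B R -> B \subset X.
Proof.
rewrite /burn_options; case: ifP => _; first by move/set1P->.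
by case/imsetP=> v _ ->; apply: subsetUr.
Qed.

Lemma legal_revealP B R S : legal_reveal k B R S ->
  #|R :|: S| = #|R| + k \/ ~: B \subset R :|: S.
Proof.
case/andP=> sS /eqP cS; case: (leqP k #|~: (B :|: R)|) => le_k.
  left; rewrite cardsU disjoint_setI0 ?cards0 ?subn0 ?cS ?(minn_idPl le_k) //.
  rewrite disjoint_sym disjoints_subset (subset_trans sS) //.
  by rewrite setCS subsetUr.
right; suff -> : S = ~: (B :|: R).
  by apply/subsetP=> x; rewrite !inE => /negPf->; rewrite orbN.
by apply/eqP; rewrite eqEcard sS cS (minn_idPr (ltnW le_k)) leqnn.
Qed.

(** Propagation alone shortens each nonempty walk from a burned vertex by one edge per round, so any
    reply of the Arsonist will do. *)
Lemma rounds_le_radius r n B R :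
  (forall v, exists2 u, u \in B & dist_le e r u v) -> rounds k e n B R <= r.
Proof.
elim: r n B R => [|r IHr] n B R near_B.
  suff -> : B = [set: V] by case: n => [|n] /=; rewrite eqxx.
  apply/setP=> v; rewrite inE.
  by have [u uB /dist_leP[[|w p] [_ /= <- //]]] := near_B v.
apply: rounds_leS => S _.
have /set0Pn[X optX] := burn_options_neq0 (spread e B) (R :|: S).
exists X => // m; apply: IHr => v.
have /subsetP sX := burn_options_sub optX.
have [u uB /dist_leP[[|w p] /= [ep lp sp]]] := near_B v.
  by exists u; [apply: sX; rewrite inE uB | apply/dist_leP; exists [::]].
case/andP: ep => euw ep; exists w; last by apply/dist_leP; exists p.
by apply: sX; rewrite !inE; apply/orP; right; apply/exists_inP; exists u.
Qed.

Definition unhit C B := [set S in C | [disjoint S & B]].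

Lemma unhit_sub C B X : B \subset X -> unhit C X \subset unhit C B.
Proof.
move=> sBX; apply/subsetP=> S; rewrite !inE => /andP[-> dSX].
by rewrite disjoint_sym (disjointWl sBX) // disjoint_sym.
Qed.

Lemma revealed_unhit C B R t :
    cover C = [set: V] -> {in C, forall S, S != set0 /\ #|S| <= k} ->
    #|unhit C B| = t.+1 -> 0 < k ->
    k * #|C| <= #|R| + k * t \/ ~: B \subset R ->
  exists2 v, v \in R & exists2 S, S \in unhit C B & v \in S.
Proof.
move=> covC smallC card_unhit k_gt0 [ltR|sR]; last first.
  have /set0Pn[S uS] : unhit C B != set0 by rewrite -card_gt0 card_unhit.
  have /[!inE]/andP[SC dSB] := uS.
  have [/set0Pn[v vS] _] := smallC S SC.
  exists v; last by exists S.
  by apply: (subsetP sR); rewrite inE (disjointFr dSB).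
have sub_unhit : unhit C B \subset C by apply/subsetP=> S /[!inE]/andP[].
pose hit := C :\: unhit C B.
have card_hit : #|hit| + t.+1 = #|C|.
  by rewrite -card_unhit addnC -(cardsID (unhit C B) C) (setIidPr sub_unhit).
have cover_hit : #|cover hit| <= #|hit| * k.
  apply: leq_trans (leq_card_cover hit) _; rewrite -sum_nat_const.
  by apply: leq_sum => S /setDP[/smallC[]].
(* The [#|C| - t.+1] hit sets cover at most [k * (#|C| - t.+1)] vertices, fewer than the
   [k * (#|C| - t)] in [R]. *)
have /subsetPn[v vR v_unhit] : ~~ (R \subset cover hit).
  by apply: contraL ltR => /subset_leq_card; rewrite -ltnNge; nia.
exists v => //; have /bigcupP[S SC vS] : v \in cover C by rewrite covC inE.
exists S => //; apply: contraR v_unhit => nS.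
by apply/bigcupP; exists S; rewrite // inE nS.
Qed.

(** Induction on [t], a bound on the number of sets still to hit. The invariant says that [k]
    vertices were revealed for each of the other [#|C| - t] sets, or that all unburned vertices are
    revealed; it is stated additively to avoid truncated subtraction. *)
Lemma rounds_le_cover C d t n B R :
    0 < k -> cover C = [set: V] ->
    {in C, forall S, [/\ S != set0, #|S| <= k & diam_le e d S]} ->
    #|unhit C B| <= t -> k * #|C| <= #|R| + k * t \/ ~: B \subset R ->
  rounds k e n B R <= t + d.
Proof.
move=> k_gt0 covC propC; elim: t n B R => [|t IHt] n B R le_unhit inv.
  (* Every set is hit, so the burned vertex in a set around [v] is within distance [d] of [v]. *)
  apply: rounds_le_radius => v.
  have /bigcupP[S SC vS] : v \in cover C by rewrite covC inE.
  have : S \notin unhit C B.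
    by move: le_unhit; rewrite leqn0 => /eqP/cards0_eq->; rewrite inE.
  rewrite inE SC => /pred0Pn[u /andP[uS uB]]; exists u => //.
  have [_ _ /forall_inP/(_ _ uS)/forall_inP] := propC S SC.
  exact.
rewrite addSn; apply: rounds_leS => S legalS; set B' := spread e B.
have sB : B \subset B' by apply: subsetUl.
(* The [k] new revelations pay for lowering [t.+1] to [t], whatever vertex is burned. *)
have inv' X : B' \subset X ->
    k * #|C| <= #|R :|: S| + k * t \/ ~: X \subset R :|: S.
  move=> sX; have sCX : ~: X \subset ~: B' by rewrite setCS.
  case: (legal_revealP legalS) => [->|/(subset_trans sCX)]; last by right.
  case: inv => [|sR]; first by left; nia.
  right; apply: subset_trans sCX (subset_trans _ (subsetUl _ _)).
  by apply: subset_trans sR; rewrite setCS.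
have le_unhit' : #|unhit C B'| <= t.+1.
  by apply: leq_trans (subset_leq_card (unhit_sub _ sB)) le_unhit.
(* If at most [t] sets are unhit after propagation, any reply works; otherwise exactly [t.+1] are,
   and the Arsonist must hit one. *)
move: le_unhit'; rewrite leq_eqVlt ltnS => /orP[/eqP eq_unhit|le_t]; last first.
  have /set0Pn[X optX] := burn_options_neq0 B' (R :|: S).
  have sX := burn_options_sub optX; exists X => // m.
  apply: IHt (inv' X sX).
  by apply: leq_trans (subset_leq_card (unhit_sub _ sX)) le_t.
have smallC : {in C, forall A, A != set0 /\ #|A| <= k} by move=> A /propC[].
have [v vR [A uA vA]] :=
  revealed_unhit covC smallC eq_unhit k_gt0 (inv' B' (subxx B')).
have /[!inE]/andP[AC dAB] := uA.
have vRB : v \in (R :|: S) :\: B' by rewrite inE (disjointFr dAB).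
exists (v |: B').
  rewrite /burn_options ifN; first exact: imset_f.
  by apply/set0Pn; exists v.
have sX : B' \subset v |: B' by apply: subsetUr.
move=> m; apply: IHt (inv' _ sX).
rewrite -ltnS -eq_unhit; apply: proper_card.
rewrite properE unhit_sub //=; apply/subsetPn; exists A => //.
by rewrite inE AC /=; apply/pred0Pn; exists v; rewrite /= vA setU11.
Qed.

Lemma burning_number_le_cover C d :
    0 < k -> cover C = [set: V] ->
    {in C, forall S, [/\ S != set0, #|S| <= k & diam_le e d S]} ->
  burning_number k e <= #|C| + d.
Proof.
move=> k_gt0 covC propC; apply: (@rounds_le_cover C) => //; last first.
  (* Initially [t] is [#|C|], so the invariant holds with nothing revealed. *)
  by left; rewrite leq_addl.
by apply/subset_leq_card/subsetP=> S /[!inE]/andP[].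
Qed.

End Arsonist.

Theorem theorem20 (V : finType) (e : rel V)
    (e_sym : symmetric e) (e_irr : irreflexive e)
    (k d : nat) (k_gt0 : 0 < k) (d_gt0 : 0 < d) :
  burning_number k e <= edge_cover_number (diam_hypergraph k d e) + d
  /\ (forall T : nat,
        (exists P : {set {set V}},
           [/\ partition P [set: V], #|P| = T
             & forall S : {set V}, S \in P -> #|S| <= k /\ diam_le e d S]) ->
        burning_number k e <= T + d).
Proof.
split=> [|_ [P [partP <- propP]]].
  (* The cover by singletons guarantees that the minimum is attained by an actual edge cover. *)
  have [[C /andP[sCH /eqP covC] <-] _] :=
    edge_cover_numberP (diam_hypergraph_cover d e k_gt0).
  apply: burning_number_le_cover => // S /(subsetP sCH).
  by rewrite inE => /and3P.
case/and3P: partP => /eqP covP _ P0.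
apply: burning_number_le_cover => // S SP; have [cS dS] := propP S SP.
by split=> //; apply: contraNneq P0 => <-.
Qed.
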